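(* Let $d \in \mathbb{N}$ and $S \in \mathcal{S}^d(1)$ with $0 \in \operatorname{int}(S)$. Then \[ (d+1)^{d+1} \le (d!)^2 \operatorname{vol}(S)\operatorname{vol}(S^* ) \le (s_{d+1}-1)^2. \] The lower bound holds with equality if and only if the unique interior integral point $0$ of $S$ is the centroid of $S$; the upper bound holds with equality if and only if $S$ is unimodularly equivalent to $T^d_{1,d+1} = \operatorname{conv}(\{0,s_1e_1,\ldots,s_de_d\})$.
   Context: The Sylvester sequence: $s_1 = 2$, $s_i = \prod_{j=1}^{i-1} s_j + 1$ for $i\ge2$. $\mathcal{S}^d(1)$: $d$-dimensional simplices in $\mathbb{R}^d$ with integral vertices and exactly one interior integral point. $S^* = \{y : \langle x, y\rangle \le 1 \ \forall x \in S\}$ is the polar body. Unimodular equivalence: existence of an affine bijection of $\mathbb{R}^d$ preserving $\mathbb{Z}^d$ mapping one onto the other. *)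

(* Defs.v *)
(* Points of R^d are row vectors 'rV[R]_d over an arbitrary
   real field R (the statement is first-order over ordered fields; R = reals is
   an instance). Sets in R^d are predicates 'rV[R]_d -> Prop. *)
From HB Require Import structures.
From mathcomp Require Import all_boot all_order all_algebra.
Set Implicit Arguments. Unset Strict Implicit. Unset Printing Implicit Defensive.
Import Order.TTheory GRing.Theory Num.Theory.
Local Open Scope ring_scope.

(* Sylvester sequence: sylvP n = s_1 * ... * s_n, s_i = sylvP (i-1) + 1 (i >= 1). *)
Fixpoint sylvP (n : nat) : nat :=
  match n with
  | 0 => 1%N
  | n'.+1 => (sylvP n' * (sylvP n' + 1))%N
  end.
Definition sylv (i : nat) : nat := (sylvP i.-1 + 1)%N.

Section Geo.
Variables (R : realFieldType) (d : nat).

Definition lattice_pt (x : 'rV[R]_d) : Prop :=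
  forall j : 'I_d, exists z : int, x ord0 j = z%:~R.

Definition convhull (v : 'I_d.+1 -> 'rV[R]_d) (x : 'rV[R]_d) : Prop :=
  exists lam : 'I_d.+1 -> R,
    (forall i, 0 <= lam i) /\ \sum_i lam i = 1 /\ x = \sum_i lam i *: v i.

Definition edge_mx (v : 'I_d.+1 -> 'rV[R]_d) : 'M[R]_d :=
  \matrix_(i < d) (v (lift ord0 i) - v ord0).

Definition simplex_nondeg (v : 'I_d.+1 -> 'rV[R]_d) : Prop :=
  \det (edge_mx v) != 0.

Definition simplex_vol (v : 'I_d.+1 -> 'rV[R]_d) : R :=
  `|\det (edge_mx v)| / (d`!)%:R.

Definition int_pt (S : 'rV[R]_d -> Prop) (x : 'rV[R]_d) : Prop :=
  exists eps : R, 0 < eps /\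
    forall y : 'rV[R]_d, (forall j, `|y ord0 j - x ord0 j| < eps) -> S y.

Definition dotp (x y : 'rV[R]_d) : R := \sum_j x ord0 j * y ord0 j.

Definition polar_body (S : 'rV[R]_d -> Prop) (y : 'rV[R]_d) : Prop :=
  forall x, S x -> dotp x y <= 1.

Definition unimod_equiv (S T : 'rV[R]_d -> Prop) : Prop :=
  exists (A : 'M[R]_d) (t : 'rV[R]_d),
    A \in unitmx /\
    (forall x, lattice_pt x <-> lattice_pt (x *m A + t)) /\
    (forall y, T y <-> exists x, S x /\ y = x *m A + t).

Definition Tvert (i : 'I_d.+1) : 'rV[R]_d :=
  match unlift ord0 i with
  | None => 0
  | Some k => (sylv k.+1)%:R *: delta_mx ord0 k
  end.
Definition Tsimplex : 'rV[R]_d -> Prop := convhull Tvert.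

Definition centroid (v : 'I_d.+1 -> 'rV[R]_d) : 'rV[R]_d :=
  (d.+1)%:R^-1 *: \sum_i v i.

End Geo.

(* Main.v *)
(** Let [beta] be the barycentric coordinates of [0] in [S].  The polar simplex has
    vertices [w_i] with [1 - <v_j, w_i> = delta_ij / beta_i], so the normalised volume
    product is [1 / prod beta_i] and the lower bound is AM-GM.

    For the upper bound, write [beta_i = b_i / D] and let [J] be a proper non-empty set of
    indices.  The vectors [D m_i - b_i sum m], with [m] integral on [J], form a lattice of
    index [D^(|J|-1) * sum_(i notin J) b_i] in [Z^J].  If the box [prod_(i in J) [0, b_i)]
    had more integer points than that, two of them would be congruent and their difference
    would yield a second interior lattice point of [S].  Hence
    [prod_J beta <= sum_(~ J) beta].  Applied to the largest coordinates, this shows as in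
    Soundararajan's proof of Curtiss' theorem that the sorted [beta] is majorised by
    [1/s_1, ..., 1/s_d, 1/(s_(d+1) - 1)], hence has at least the same product.

    In the equality case the box meets every class exactly once.  The class of a lattice
    point outside the span of the [v_i], [i in J], would again produce a second interior
    point; so [d] of the vertices of [S] form a basis of [Z^d], the remaining one is
    determined by [beta], and the same holds for the Sylvester simplex. *)
Require Import Defs.
From HB Require Import structures.
From mathcomp Require Import all_boot all_order all_algebra.
From mathcomp Require Import all_fingroup ring lra zify.
Import Order.TTheory GRing.Theory Num.Theory.
Set Implicit Arguments.
Unset Strict Implicit.
Unset Printing Implicit Defensive.
Local Open Scope ring_scope.

(** * Sequences majorised by the Sylvester fractions *)

Section Sequences.
Variable R : realFieldType.
Implicit Types (x y a c u : nat -> R) (n k d : nat).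

(** Summation by parts: as the partial sums of [u] are nonnegative, lowering the coefficient [c k]
    to [c k.+1] can only lower the running bound. *)
Lemma abel_sum_ge0 c u n :
  (forall i, (i.+1 < n)%N -> c i.+1 <= c i) -> (forall i, (i < n)%N -> 0 <= c i) ->
  (forall k, (k <= n)%N -> 0 <= \sum_(i < k) u i) ->
  0 <= \sum_(i < n) c i * u i.
Proof.
move=> cdec c0 u0.
case: n cdec c0 u0 => [|n] cdec c0 u0; first by rewrite big_ord0.
suff H k : (k <= n)%N ->
    c k * (\sum_(i < k.+1) u i) <= \sum_(i < k.+1) c i * u i.
  by apply: le_trans (H n _); rewrite ?mulr_ge0 ?c0 ?u0.
elim: k => [|k IH] kn; first by rewrite !big_ord_recr !big_ord0 /= !add0r.
rewrite [\sum_(i < k.+2) u i]big_ord_recr [leRHS]big_ord_recr /= mulrDr lerD2r.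
apply: le_trans (IH (ltnW kn)); apply: ler_wpM2r; first exact/u0/ltnW.
exact: cdec.
Qed.

Lemma prod_ge1_sum_ge a n : (forall i, (i < n)%N -> 0 < a i) ->
  1 <= \prod_(i < n) a i -> n%:R <= \sum_(i < n) a i.
Proof.
move=> a0 p1; case: n a0 p1 => [|n] a0 p1; first by rewrite big_ord0.
have [] := @leif_AGM R 'I_n.+1 predT (fun i => a i) => [i _|]; first by rewrite ltW ?a0.
rewrite card_ord => le_p _; rewrite leNgt; apply/negP => lt_n.
have := le_trans p1 le_p; apply/negP; rewrite -ltNge exprn_ilt1 //.
  by rewrite divr_ge0 ?ler0n // sumr_ge0 // => i _; rewrite ltW ?a0.
by rewrite ltr_pdivrMr ?ltr0n // mul1r.
Qed.

(** The excesses [y i / x i - 1] have nonnegative partial sums by AM-GM; weighting them with the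
    decreasing [x i] and summing by parts gives the claim. *)
Lemma sum_le_of_prod_le x y n :
  (forall i, (i.+1 < n)%N -> x i.+1 <= x i) ->
  (forall i, (i < n)%N -> 0 < x i) -> (forall i, (i < n)%N -> 0 < y i) ->
  (forall k, (k <= n)%N -> \prod_(i < k) x i <= \prod_(i < k) y i) ->
  \sum_(i < n) x i <= \sum_(i < n) y i.
Proof.
move=> xdec x0 y0 pxy; rewrite -subr_ge0 -sumrB.
rewrite (eq_bigr (fun i : 'I_n => x i * (y i / x i - 1))); last first.
  by move=> i _; rewrite mulrBr mulr1 mulrC divfK // gt_eqF // x0.
apply: (@abel_sum_ge0 x (fun i => y i / x i - 1)) => [//|i /x0/ltW//|k kn].
rewrite sumrB subr_ge0 sumr_const card_ord.
have px : 0 < \prod_(i < k) x i.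
  by apply: prodr_gt0 => i _; apply/x0/(leq_trans (ltn_ord i)).
apply: (@prod_ge1_sum_ge (fun i => y i / x i)) => [i ik|].
  by rewrite divr_gt0 ?x0 ?y0 // (leq_trans ik).
by rewrite prodf_div ler_pdivlMr // mul1r pxy.
Qed.

(** By AM-GM on the ratios [y i / x i], it is enough that they sum to at most [n]. Equality makes
    all ratios equal, with product 1. *)
Lemma prod_ge_of_major x y n :
  (forall i, (i.+1 < n)%N -> x i.+1 <= x i) ->
  (forall i, (i < n)%N -> 0 < x i) -> (forall i, (i < n)%N -> 0 < y i) ->
  (forall k, (k <= n)%N -> \sum_(i < k) x i <= \sum_(i < k) y i) ->
  \sum_(i < n) x i = \sum_(i < n) y i ->
  \prod_(i < n) y i <= \prod_(i < n) x i /\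
  (\prod_(i < n) y i = \prod_(i < n) x i -> forall i, (i < n)%N -> x i = y i).
Proof.
case: n => [|n] xdec x0 y0 sxy exy.
  by rewrite !big_ord0; split.
have px : 0 < \prod_(i < n.+1) x i by apply: prodr_gt0 => i _; apply/x0.
have le_n : \sum_(i < n.+1) y i / x i <= n.+1%:R.
  (* These weights are nonnegative and decreasing; their constant part [(x n)^-1] drops out because
     the two totals agree. *)
  have : 0 <= \sum_(i < n.+1) ((x n)^-1 - (x i)^-1) * (y i - x i).
    have xmono i : (i <= n)%N -> x n <= x i.
      move=> le_in; suff H k : (k + i <= n)%N -> x (k + i)%N <= x i.
        by have := H (n - i)%N; rewrite subnK //; apply.
      elim: k => // k IH kn; rewrite addSn; apply: le_trans (IH (ltnW kn)).
      exact: xdec.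
    apply: (@abel_sum_ge0 (fun i => (x n)^-1 - (x i)^-1) (fun i => y i - x i)) => [i ii|i ii|k kn] /=.
    - rewrite lerD2l lerN2 lef_pV2 ?xdec // posrE x0 //; lia.
    - by rewrite subr_ge0 lef_pV2 ?posrE ?x0 ?xmono.
    - by rewrite sumrB subr_ge0 sxy.
  under eq_bigr do rewrite mulrBl.
  rewrite sumrB -mulr_sumr sumrB exy subrr mulr0 sub0r oppr_ge0.
  under eq_bigr => i _ do rewrite mulrBr mulVf ?gt_eqF ?x0 // mulrC.
  by rewrite sumrB sumr_const card_ord subr_le0.
have [] := @leif_AGM R 'I_n.+1 predT (fun i => y i / x i) => [i _|].
  by rewrite divr_ge0 // ltW ?x0 ?y0.
rewrite card_ord prodf_div => le_p eq_p.
have le1 : ((\sum_(i < n.+1) y i / x i) / n.+1%:R) ^+ n.+1 <= 1.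
  rewrite exprn_ile1 ?divr_ge0 ?ler0n ?ler_pdivrMr ?ltr0n ?mul1r //.
  by rewrite sumr_ge0 // => i _; rewrite divr_ge0 // ltW ?x0 ?y0.
split.
  by have := le_trans le_p le1; rewrite ler_pdivrMr // mul1r.
move=> e.
have e1 : (\prod_(i < n.+1) y i) / (\prod_(i < n.+1) x i) = 1 by rewrite e divff ?gt_eqF.
move: eq_p; rewrite e1 (_ : (_ == _) = true); last first.
  by apply/eqP/le_anti; rewrite le1 andbT -[X in X <= _]e1.
move=> /esym/forall_inP H.
have E (i j : 'I_n.+1) : y i / x i = y j / x j.
  by have /forall_inP/(_ j isT)/eqP := H i isT.
move=> i ii.
have : (y i / x i) ^+ n.+1 = 1.
  rewrite -e1 -prodf_div -[X in _ ^+ X](card_ord n.+1) -prodr_const.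
  by apply: eq_bigr => j _; rewrite (E (Ordinal ii) j).
move/eqP; rewrite pexpr_eq1 ?divr_ge0 ?ltW ?x0 ?y0 //.
by move/eqP => h; rewrite -[RHS](@divfK _ (x i)) ?gt_eqF ?x0 // h mul1r.
Qed.

Lemma sylvP_gt0 n : (0 < sylvP n)%N.
Proof. by elim: n => //= n IH; rewrite muln_gt0 IH addn1. Qed.

Lemma prod_sylv n : \prod_(i < n) ((sylv i.+1)%:R : R)^-1 = (sylvP n)%:R^-1.
Proof.
elim: n => [|n IH]; first by rewrite big_ord0 invr1.
by rewrite big_ord_recr /= IH /sylv /= natrM invfM.
Qed.

Lemma sum_sylv n : \sum_(i < n) ((sylv i.+1)%:R : R)^-1 = 1 - (sylvP n)%:R^-1.
Proof.
elim: n => [|n IH]; first by rewrite big_ord0 invr1 subrr.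
rewrite big_ord_recr /= IH /sylv /= natrM natrD.
have : 0 < (sylvP n)%:R :> R by rewrite ltr0n sylvP_gt0.
by move=> h; field; rewrite !gt_eqF //; lra.
Qed.

(** [sylvP d] is s_(d+1) - 1, so the last entry completes the sum to 1. *)
Definition sylv_bary d i : R :=
  if (i < d)%N then (sylv i.+1)%:R^-1 else (sylvP d)%:R^-1.

Lemma sylv_bary_gt0 d i : 0 < sylv_bary d i.
Proof.
by rewrite /sylv_bary; case: ifP => _; rewrite invr_gt0 ltr0n ?sylvP_gt0 // /sylv addn1.
Qed.

Lemma sum_sylv_bary d k : (k <= d)%N -> \sum_(i < k) sylv_bary d i = 1 - (sylvP k)%:R^-1.
Proof.
move=> kd; rewrite -sum_sylv; apply: eq_bigr => i _.
by rewrite /sylv_bary (leq_trans (ltn_ord i) kd).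
Qed.

Lemma sum_sylv_baryT d : \sum_(i < d.+1) sylv_bary d i = 1.
Proof. by rewrite big_ord_recr /= sum_sylv_bary // /sylv_bary ltnn subrK. Qed.

Lemma prod_sylv_bary d : \prod_(i < d) sylv_bary d i = (sylvP d)%:R^-1.
Proof. by rewrite -prod_sylv; apply: eq_bigr => i _; rewrite /sylv_bary ltn_ord. Qed.

Lemma prod_sylv_baryT d : \prod_(i < d.+1) sylv_bary d i = (sylvP d)%:R ^- 2.
Proof. by rewrite big_ord_recr /= prod_sylv_bary /sylv_bary ltnn -invfM. Qed.

(* Soundararajan's argument: compare with the Sylvester fractions only after the
   last index at which the partial product of [x] is still at least theirs. *)
Lemma tail_ge_sylv x d :
  (forall i, (i < d)%N -> 0 < x i) -> (forall i, (i.+1 < d)%N -> x i.+1 <= x i) ->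
  (forall j, (j <= d)%N -> \prod_(i < j) x i <= 1 - \sum_(i < j) x i) ->
  forall k, (k <= d)%N -> (sylvP k)%:R^-1 <= 1 - \sum_(i < k) x i.
Proof.
move=> x0 xdec ps k kd.
pose Q j := (j <= k)%N && ((sylvP j)%:R^-1 <= \prod_(i < j) x i).
have exQ : exists j, Q j by exists 0%N; rewrite /Q big_ord0 invr1 lexx.
have ubQ j : Q j -> (j <= k)%N by case/andP.
case: (ex_maxnP exQ ubQ) => j /andP[jk pj] jmax.
have rj := le_trans pj (ps _ (leq_trans jk kd)).
have px l : (l <= d)%N -> 0 < \prod_(i < l) x i.
  by move=> ld; apply: prodr_gt0 => i _; apply/x0/(leq_trans (ltn_ord i)).
have s0 i : 0 < (sylv i.+1)%:R^-1 :> R by rewrite invr_gt0 ltr0n /sylv addn1.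
have seg : \sum_(i < k - j) x (j + i)%N <= \sum_(i < k - j) (sylv (j + i).+1)%:R^-1.
  apply: (@sum_le_of_prod_le (fun i => x (j + i)%N) (fun i => (sylv (j + i).+1)%:R^-1)) => [i|i|//|l].
  - by move=> ?; rewrite addnS xdec; lia.
  - by move=> ?; rewrite x0; lia.
  case: (posnP l) => [->|l0] lk; first by rewrite !big_ord0.
  (* Beyond the maximal [j] the products of [x] are strictly smaller. Dividing out the first [j]
     factors, where [x] has at least as much, compares the segments. *)
  have : ~~ Q (j + l)%N.
    by apply/negP => /jmax; lia.
  rewrite /Q negb_and -ltNge; case/orP => [?|]; first by exfalso; lia.
  rewrite -prod_sylv !big_split_ord /= => lt_p.
  have lt0 : 0 < \prod_(i < l) ((sylv (j + i).+1)%:R : R)^-1 by apply: prodr_gt0.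
  have := lt_le_trans lt_p (ler_wpM2r (ltW lt0) _) => /(_ (\prod_(i < j) x i)).
  rewrite prod_sylv => /(_ pj); rewrite ltr_pM2l; first exact: ltW.
  by apply: px; lia.
have E (f : nat -> R) : \sum_(i < k) f i = \sum_(i < j) f i + \sum_(i < k - j) f (j + i)%N.
  by move: (k - j)%N (subnKC jk) => l <-; rewrite big_split_ord.
have := sum_sylv k; rewrite (E (fun i => (sylv i.+1)%:R^-1)) sum_sylv (E x).
lra.
Qed.

Lemma prod_ge_sylv x d :
  (forall i, (i <= d)%N -> 0 < x i) -> (forall i, (i < d)%N -> x i.+1 <= x i) ->
  \sum_(i < d.+1) x i = 1 ->
  (forall j, (j <= d)%N -> \prod_(i < j) x i <= 1 - \sum_(i < j) x i) ->
  (sylvP d)%:R ^- 2 <= \prod_(i < d.+1) x i /\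
  ((sylvP d)%:R ^- 2 = \prod_(i < d.+1) x i -> forall i, (i <= d)%N -> x i = sylv_bary d i).
Proof.
move=> x0 xdec x1 ps; rewrite -prod_sylv_baryT.
apply: prod_ge_of_major => // [i _|k|]; first exact: sylv_bary_gt0.
- rewrite leq_eqVlt => /orP[/eqP->|kd]; first by rewrite x1 sum_sylv_baryT.
  rewrite sum_sylv_bary // lerBrDl -lerBrDr; apply: (@tail_ge_sylv x d) => // i id.
    exact/x0/ltnW.
  exact/xdec/ltnW.
- by rewrite x1 sum_sylv_baryT.
Qed.

End Sequences.

(** * A pigeonhole principle modulo a lattice *)

Section Pigeonhole.
Variables (I : finType) (J : {set I}) (i0 : I) (b : I -> nat) (D g : nat).
Hypotheses (i0J : i0 \in J) (g_gt0 : (0 < g)%N) (DE : D = (\sum_(i in J) b i + g)%N).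
Implicit Types (y m : I -> int).

(** With [b = D * beta], such a [y] is [D] times the weights [m] of an integral combination of
    vertices, minus the multiple of [beta] of the same total weight. *)
Definition int_lat y : Prop :=
  exists m, forall i, i \in J -> y i = D%:Z * m i - (b i)%:Z * \sum_(i in J) m i.

(* [key] is a complete invariant of the classes of [Z^J] modulo the lattice [int_lat]; the
   component at [i0] records only the coordinate sum, since the other congruences modulo [D]
   force the one at [i0]. *)
Definition key_bound i : nat := if i == i0 then g else if i \in J then D else 1%N.

Definition key_val y i : int :=
  let s := \sum_(i in J) y i in
  if i == i0 then (s %% g)%Z
  else if i \in J then ((y i + (b i)%:Z * (s %/ g)%Z) %% D)%Z else 0.

Lemma key_val_ge0 y i : 0 <= key_val y i.
Proof.
have D_gt0 : (0 < D)%N by rewrite DE; lia.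
by rewrite /key_val; case: ifP => _; [|case: ifP => _ //]; apply: modz_ge0; lia.
Qed.

Lemma key_val_lt y i : (`|key_val y i| < key_bound i)%N.
Proof.
have D_gt0 : (0 < D)%N by rewrite DE; lia.
have := key_val_ge0 y i; rewrite /key_val /key_bound.
case: ifP => _ h; [|case: ifP h => _ h //].
  by rewrite -ltz_nat gez0_abs // ltz_pmod.
by rewrite -ltz_nat gez0_abs // ltz_pmod.
Qed.

Definition key y : {dffun forall i, 'I_(key_bound i)} :=
  [ffun i => Ordinal (key_val_lt y i)].

(** The coordinates of [y - y'] sum to [g * M]; adding [b i * M] to each makes the total [D * M], by
    [DE]. Divisibility by [D] away from [i0] thus forces it at [i0], and the quotients are the
    required [m]. *)
Lemma key_eqP y y' : key y = key y' -> int_lat (fun i => y i - y' i).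
Proof.
move=> /ffunP kE.
have {kE}E i : key_val y i = key_val y' i.
  have := kE i; rewrite !ffunE => -[/(congr1 Posz)].
  by rewrite !gez0_abs ?key_val_ge0.
have D_gt0 : (0 < D)%N by rewrite DE; lia.
have g0 : g%:Z != 0 by lia.
pose s := \sum_(i in J) y i; pose s' := \sum_(i in J) y' i.
pose M : int := (s %/ g)%Z - (s' %/ g)%Z.
have sM : \sum_(i in J) (y i - y' i) = g%:Z * M.
  rewrite sumrB -/s -/s' {1}(divz_eq s g) {1}(divz_eq s' g) /M.
  have := E i0; rewrite /key_val eqxx -/s -/s' => ->; ring.
have dvdD i : i \in J -> i != i0 -> (D %| y i - y' i + (b i)%:Z * M)%Z.
  move=> iJ ne; have := E i; rewrite /key_val (negbTE ne) iJ -/s -/s'.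
  move/eqP; rewrite eqz_mod_dvd /M => h.
  by rewrite (_ : _ + _ = y i + (b i)%:Z * (s %/ g)%Z - (y' i + (b i)%:Z * (s' %/ g)%Z)) //; ring.
have sumD : \sum_(i in J) (y i - y' i + (b i)%:Z * M) = D%:Z * M.
  rewrite big_split /= sM -mulr_suml DE PoszD mulrDl addrC; congr (_ * _ + _).
  by rewrite (big_morph Posz PoszD (erefl 0)).
have dvdD0 : (D %| y i0 - y' i0 + (b i0)%:Z * M)%Z.
  have : (D %| \sum_(i in J) (y i - y' i + (b i)%:Z * M))%Z by rewrite sumD dvdz_mulr.
  rewrite (bigD1 i0) //= rpredDr //; apply: rpred_sum => i /andP[]; exact: dvdD.
exists (fun i => ((y i - y' i + (b i)%:Z * M) %/ D)%Z).
have mE i : i \in J -> D%:Z * ((y i - y' i + (b i)%:Z * M) %/ D)%Z = y i - y' i + (b i)%:Z * M.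
  move=> iJ; rewrite mulrC; apply: divzK.
  by have [->|] := eqVneq i i0; [exact: dvdD0 | exact: dvdD].
have -> : \sum_(i in J) ((y i - y' i + (b i)%:Z * M) %/ D)%Z = M.
  apply: (@mulfI _ D%:Z); first by lia.
  by rewrite mulr_sumr -sumD; apply: eq_bigr.
by move=> i iJ; rewrite mE // addrK.
Qed.

(** The bound 1 outside [J] pins those coordinates to 0, so functions on all of [I] encode the
    points of the box over [J]. *)
Definition box_bound i : nat := if i \in J then b i else 1%N.

Lemma card_ord_dffun (n : I -> nat) :
  #|{dffun forall i, 'I_(n i)}| = (\prod_i n i)%N.
Proof.
rewrite card_dep_ffun foldrE big_map -big_enum /=.
by apply: eq_bigr => i _; rewrite card_ord.
Qed.

Lemma card_box : #|{dffun forall i, 'I_(box_bound i)}| = (\prod_(i in J) b i)%N.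
Proof. by rewrite card_ord_dffun [RHS]big_mkcond. Qed.

Lemma card_key : #|{dffun forall i, 'I_(key_bound i)}| = (g * D ^ #|J|.-1)%N.
Proof.
rewrite card_ord_dffun (bigD1 i0) //= {1}/key_bound eqxx; congr (_ * _)%N.
rewrite (eq_bigr (fun i => if i \in J :\ i0 then D else 1%N)); last first.
  by move=> i /negbTE ni; rewrite /key_bound ni !inE ni.
rewrite -big_mkcondr /= (eq_bigl (mem (J :\ i0))) ?prod_nat_const.
  by rewrite [in RHS](cardsD1 i0) i0J.
by move=> i; rewrite !inE andbA andbb.
Qed.

Definition box_val (x : {dffun forall i, 'I_(box_bound i)}) i : int := (x i : nat)%:Z.

Lemma box_valP x i : i \in J -> 0 <= box_val x i < (b i)%:Z.
Proof.
move=> iJ; rewrite /box_val; move: (nat_of_ord (x i)) (ltn_ord (x i)) => k.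
by rewrite /box_bound iJ => h; lia.
Qed.

(** This is what a collision of two box points produces and what the simplex will forbid. *)
Definition small_vector : Prop :=
  exists y, [/\ int_lat y, forall i, i \in J -> `|y i| < (b i)%:Z
            & exists2 i, i \in J & y i != 0].

Lemma collision : ~ injective (fun x => key (box_val x)) -> small_vector.
Proof.
move=> ninj.
have /injectivePn[x [x' ne exx']] : ~~ injectiveb (fun x => key (box_val x)).
  by apply/injectiveP.
exists (fun i => box_val x i - box_val x' i); split; first exact: key_eqP.
  by move=> i iJ; have := box_valP x iJ; have := box_valP x' iJ; lia.
have [i nei] : exists i, x i != x' i.
  apply/existsP; rewrite -negb_forall; apply: contra ne => /forallP h.
  by apply/eqP/ffunP => i; apply/eqP.
have H : (x i : nat) != x' i by [].
exists i; last by rewrite /box_val subr_eq0 eqz_nat.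
(* Distinct box points differ only inside [J]: elsewhere both entries are 0. *)
apply: contraT => iJ.
move: (nat_of_ord (x i)) (nat_of_ord (x' i)) (ltn_ord (x i)) (ltn_ord (x' i)) H.
rewrite /box_bound (negbTE iJ); lia.
Qed.

Lemma small_vector_exists : (g * D ^ #|J|.-1 < \prod_(i in J) b i)%N -> small_vector.
Proof.
move=> lt_c; apply: collision => /leq_card.
by rewrite card_box card_key leqNgt lt_c.
Qed.

(** Without small vectors [key] is injective on the box, hence onto when the two cardinalities
    agree. *)
Lemma box_cover : (g * D ^ #|J|.-1 = \prod_(i in J) b i)%N -> ~ small_vector ->
  forall y, exists2 x : I -> int, (forall i, i \in J -> 0 <= x i < (b i)%:Z) &
    int_lat (fun i => x i - y i).
Proof.
move=> eq_c nosmall y.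
have /injectiveP inj : injectiveb (fun x => key (box_val x)).
  by apply: contraT => /injectiveP/collision.
have /(inj_card_onto inj)/(_ (key y))/codomP[x kx] :
    (#|{dffun forall i, 'I_(key_bound i)}| <= #|{dffun forall i, 'I_(box_bound i)}|)%N.
  by rewrite card_box card_key eq_c.
exists (box_val x); first by move=> i; apply: box_valP.
exact/key_eqP/esym.
Qed.

End Pigeonhole.

(** * Barycentric coordinates and integrality *)

Section IntVal.
Variable R : realFieldType.
Implicit Types x y : R.

Definition int_val x : Prop := exists z : int, x = z%:~R.

Lemma int_valz (z : int) : int_val z%:~R. Proof. by exists z. Qed.

Lemma int_valD x y : int_val x -> int_val y -> int_val (x + y).
Proof. by move=> [m ->] [n ->]; exists (m + n); rewrite rmorphD. Qed.

Lemma int_valM x y : int_val x -> int_val y -> int_val (x * y).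
Proof. by move=> [m ->] [n ->]; exists (m * n); rewrite rmorphM. Qed.

Lemma int_valN x : int_val x -> int_val (- x).
Proof. by move=> [m ->]; exists (- m); rewrite rmorphN. Qed.

Lemma int_val_sum (I : finType) (P : pred I) (F : I -> R) :
  (forall i, P i -> int_val (F i)) -> int_val (\sum_(i | P i) F i).
Proof. by move=> h; apply: big_ind => //; [exact: int_valz 0 | exact: int_valD]. Qed.

Lemma int_val_prod (I : finType) (P : pred I) (F : I -> R) :
  (forall i, P i -> int_val (F i)) -> int_val (\prod_(i | P i) F i).
Proof. by move=> h; apply: big_ind => //; [exact: int_valz 1 | exact: int_valM]. Qed.

Lemma int_val_sign n : int_val ((-1) ^+ n).
Proof. by exists ((-1) ^+ n); rewrite rmorphXn rmorphN1. Qed.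

Lemma int_val_det n (A : 'M[R]_n) : (forall i j, int_val (A i j)) -> int_val (\det A).
Proof.
move=> hA; apply: int_val_sum => s _; apply: int_valM; first exact: int_val_sign.
exact: int_val_prod.
Qed.

Lemma int_val_adj n (A : 'M[R]_n) i j : (forall i j, int_val (A i j)) -> int_val (\adj A i j).
Proof.
move=> hA; rewrite mxE; apply: int_valM; first exact: int_val_sign.
by apply: int_val_det => k l; rewrite !mxE.
Qed.

Lemma lattice_sum d (I : finType) (c : I -> R) (v : I -> 'rV[R]_d) :
  (forall i, int_val (c i)) -> (forall i, lattice_pt (v i)) -> lattice_pt (\sum_i c i *: v i).
Proof.
move=> hc hv j; rewrite summxE; apply: int_val_sum => i _.
by rewrite mxE; apply: int_valM; [exact: hc | exact: hv].
Qed.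

Lemma latticeD d (x y : 'rV[R]_d) : lattice_pt x -> lattice_pt y -> lattice_pt (x + y).
Proof. by move=> hx hy j; rewrite mxE; apply: int_valD. Qed.

Lemma latticeN d (x : 'rV[R]_d) : lattice_pt x -> lattice_pt (- x).
Proof. by move=> hx j; rewrite mxE; apply: int_valN. Qed.

End IntVal.

Section Barycentric.
Variables (R : realFieldType) (d : nat).
Implicit Types (v : 'I_d.+1 -> 'rV[R]_d) (x y : 'rV[R]_d) (c : 'I_d.+1 -> R).

(** A leading 1 makes affine combinations linear, so barycentric coordinates come from inverting one
    square matrix. *)
Definition hom_row x : 'rV[R]_d.+1 := row_mx (1%:M : 'M_1) x.
Definition hom_mx v : 'M[R]_d.+1 := \matrix_(i < d.+1) hom_row (v i).
Definition bary v x i : R := (hom_row x *m invmx (hom_mx v)) ord0 i.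

Lemma lshift10 : lshift d (ord0 : 'I_1) = ord0 :> 'I_d.+1.
Proof. exact: val_inj. Qed.

Lemma rshift1 k : rshift 1 k = lift ord0 k :> 'I_d.+1.
Proof. exact: val_inj. Qed.

Lemma hom_rowE0 x : hom_row x ord0 ord0 = 1.
Proof. by rewrite /hom_row -lshift10 (@row_mxEl _ _ 1 d) mxE. Qed.

Lemma hom_rowES x k : hom_row x ord0 (lift ord0 k) = x ord0 k.
Proof. by rewrite /hom_row -rshift1 (@row_mxEr _ _ 1 d). Qed.

Lemma hom_mxE0 v i : hom_mx v i ord0 = 1.
Proof. by rewrite mxE hom_rowE0. Qed.

Lemma hom_mxES v i k : hom_mx v i (lift ord0 k) = v i ord0 k.
Proof. by rewrite mxE hom_rowES. Qed.

(** Subtracting the first row from the others leaves the edge vectors below a leading 1. *)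
Lemma det_hom v : \det (hom_mx v) = \det (edge_mx v).
Proof.
have -> : hom_mx v = (block_mx (1%:M : 'M_1) 0 (const_mx 1) 1%:M : 'M_(1 + d)) *m
                     (block_mx (1%:M : 'M_1) (v ord0) 0 (edge_mx v) : 'M_(1 + d)).
  rewrite mulmx_block !mul1mx !mul0mx !mulmx1 !addr0.
  apply/matrixP => i j.
  case: (unliftP ord0 j) => [k|] ->; case: (unliftP ord0 i) => [l|] ->.
  - rewrite hom_mxES -!rshift1 (@block_mxEdr _ 1 d 1 d) !mxE big_ord1 !mxE mul1r rshift1.
    by rewrite addrC subrK.
  - by rewrite hom_mxES -rshift1 -[X in _ = fun_of_matrix _ X _]lshift10 (@block_mxEur _ 1 d 1 d).
  - by rewrite hom_mxE0 -rshift1 -lshift10 (@block_mxEdl _ 1 d 1 d) !mxE.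
  - by rewrite hom_mxE0 -lshift10 (@block_mxEul _ 1 d 1 d) !mxE.
by rewrite det_mulmx (@det_lblock _ 1 d) (@det_ublock _ 1 d) !det1 !mul1r.
Qed.

Lemma row_mul_hom v c :
  (\row_i c i) *m hom_mx v = row_mx ((\sum_i c i)%:M : 'M_1) (\sum_i c i *: v i) :> 'rV_(1 + d).
Proof.
apply/rowP => j; rewrite mxE.
case: (unliftP ord0 j) => [k|] ->.
  rewrite -[in RHS]rshift1 (@row_mxEr _ _ 1 d) summxE; apply: eq_bigr => i _.
  by rewrite hom_mxES !mxE.
rewrite -[in RHS]lshift10 (@row_mxEl _ _ 1 d) mxE mulr1n; apply: eq_bigr => i _.
by rewrite hom_mxE0 !mxE mulr1.
Qed.

Section Nondeg.
Variable v : 'I_d.+1 -> 'rV[R]_d.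
Hypothesis nondeg : simplex_nondeg v.

Lemma hom_unit : hom_mx v \in unitmx.
Proof. by rewrite unitmxE det_hom unitfE. Qed.

Lemma bary_mul x : (\row_i bary v x i) *m hom_mx v = hom_row x.
Proof.
rewrite (_ : \row_i _ = hom_row x *m invmx (hom_mx v)) ?mulmxKV ?hom_unit //.
by apply/rowP => i; rewrite mxE.
Qed.

Lemma sum_bary x : \sum_i bary v x i = 1.
Proof.
have := bary_mul x; rewrite row_mul_hom => /(@eq_row_mx _ 1 1 d)[/matrixP/(_ ord0 ord0)].
by rewrite !mxE.
Qed.

Lemma baryE x : \sum_i bary v x i *: v i = x.
Proof. by have := bary_mul x; rewrite row_mul_hom => /(@eq_row_mx _ 1 1 d)[]. Qed.

Lemma bary_uniq c : \sum_i c i = 1 -> forall i, bary v (\sum_i c i *: v i) i = c i.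
Proof.
move=> c1 i; rewrite /bary.
have -> : hom_row (\sum_i c i *: v i) = (\row_i c i) *m hom_mx v.
  by rewrite row_mul_hom c1.
by rewrite mulmxK ?hom_unit // mxE.
Qed.

Lemma baryB x y i :
  bary v y i - bary v x i = \sum_k (y ord0 k - x ord0 k) * invmx (hom_mx v) (lift ord0 k) i.
Proof.
rewrite /bary !mxE !(big_ord_recl d) !hom_rowE0 opprD addrACA subrr add0r -sumrB.
by apply: eq_bigr => k _; rewrite !hom_rowES mulrBl.
Qed.

(** Barycentric coordinates are affine with Lipschitz constant at most [K] in the maximum norm, and
    [m] is a positive lower bound for those of [x]; on the cube of radius [m / K] they stay
    nonnegative. *)
Lemma int_pt_of_bary_gt0 x : (forall i, 0 < bary v x i) -> int_pt (convhull v) x.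
Proof.
move=> x0; pose K : R := 1 + \sum_i \sum_k `|invmx (hom_mx v) (lift ord0 k) i|.
have K0 : 0 < K.
  by rewrite ltr_pwDl // sumr_ge0 // => i _; rewrite sumr_ge0.
pose m := \big[Num.min/1]_i bary v x i.
have m0 : 0 < m by apply: (big_ind (fun z : R => 0 < z)) => // a b a0 b0; rewrite lt_min a0.
have mle i : m <= bary v x i by exact: bigmin_le_cond.
exists (m / K); split=> [|y hy]; first exact: divr_gt0.
exists (bary v y); split; last by rewrite sum_bary baryE.
move=> i; rewrite -(subrK (bary v x i) (bary v y i)) baryB -lerBlDr sub0r.
apply: (@le_trans _ _ (- m)); first by rewrite lerN2.
suff : `|\sum_k (y ord0 k - x ord0 k) * invmx (hom_mx v) (lift ord0 k) i| <= m.
  by rewrite ler_norml => /andP[].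
apply: le_trans (ler_norm_sum _ _ _) _.
apply: (@le_trans _ _ (\sum_k (m / K) * `|invmx (hom_mx v) (lift ord0 k) i|)).
  by apply: ler_sum => k _; rewrite normrM ler_wpM2r // ltW.
rewrite -mulr_sumr mulrAC ler_pdivrMr // ler_pM2l // /K (bigD1 i) //= addrCA.
by rewrite lerDl addr_ge0 // sumr_ge0 // => j _; rewrite sumr_ge0.
Qed.

(** Push [x] away from [v i] by a small factor [t]: the coordinate [i] becomes
    [(1 + t) * bary v x i - t] and is still nonnegative. *)
Lemma bary_gt0_of_int_pt x : int_pt (convhull v) x -> forall i, 0 < bary v x i.
Proof.
move=> [eps [eps0 hx]] i.
pose K : R := 1 + \sum_k `|x ord0 k - v i ord0 k|.
have K0 : 0 < K by rewrite ltr_pwDl // sumr_ge0.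
have t0 : 0 < eps / K by exact: divr_gt0.
have tK : eps / K * K = eps by rewrite divfK // gt_eqF.
move: (eps / K) t0 tK => t t0 tK.
have [|lam [lam0 [lam1 E]]] := hx (x + t *: (x - v i)).
  move=> k; rewrite !mxE addrAC subrr add0r normrM gtr0_norm //.
  rewrite -tK ltr_pM2l // /K (bigD1 k) //= addrCA ltrDl.
  by rewrite ltr_pwDl // sumr_ge0.
pose c j := (1 + t) * bary v x j - t * (j == i)%:R.
have c1 : \sum_j c j = 1.
  rewrite sumrB -!mulr_sumr sum_bary (bigD1 i) //= eqxx big1 => [|j /negbTE->//].
  by rewrite addr0 !mulr1 addrK.
have cE : \sum_j c j *: v j = \sum_j lam j *: v j.
  rewrite -E; under eq_bigr do rewrite scalerBl -!scalerA.
  rewrite sumrB -!scaler_sumr baryE (bigD1 i) //= eqxx big1 => [|j /negbTE->]; last by rewrite scale0r.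
  by rewrite scale1r addr0 scalerDl scale1r scalerBr addrA.
have := bary_uniq lam1 i; rewrite -cE bary_uniq // => ci.
have := lam0 i; rewrite -ci /c eqxx mulr1 subr_ge0 => h.
have : 0 < (1 + t) * bary v x i by apply: lt_le_trans h.
by rewrite pmulr_rgt0 //; lra.
Qed.

(** Cramer's rule: the determinant times the inverse matrix is the integral adjugate. *)
Lemma int_val_bary x i : (forall i, lattice_pt (v i)) -> lattice_pt x ->
  int_val (`|\det (hom_mx v)| * bary v x i).
Proof.
move=> hv hx.
have hh i' j' : int_val (hom_mx v i' j').
  case: (unliftP ord0 j') => [k|] ->; first by rewrite hom_mxES; apply: hv.
  by rewrite hom_mxE0; exact: (int_valz _ 1).
suff h : int_val (\det (hom_mx v) * bary v x i).
  by case: (ger0P (\det (hom_mx v))) => // _; rewrite mulNr; apply: int_valN.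
rewrite /bary mxE mulr_sumr; apply: int_val_sum => k _.
rewrite mulrCA; apply: int_valM.
  case: (unliftP ord0 k) => [l|] ->; first by rewrite hom_rowES; apply: hx.
  by rewrite hom_rowE0; exact: (int_valz _ 1).
rewrite /invmx hom_unit mxE mulrA divff ?mul1r; first exact: int_val_adj.
by rewrite det_hom.
Qed.

End Nondeg.
End Barycentric.

(** * Simplices with one interior lattice point *)

Section OneInteriorPoint.
Variables (R : realFieldType) (d : nat) (v : 'I_d.+1 -> 'rV[R]_d).
Hypotheses (lat_v : forall i, lattice_pt (v i)) (nondeg : simplex_nondeg v).

(** Phrased through weights, with positivity standing for interiority, so that it applies directly
    to explicit combinations of the vertices. *)
Definition unique_interior : Prop := forall c : 'I_d.+1 -> R,
  \sum_i c i = 1 -> (forall i, 0 < c i) -> lattice_pt (\sum_i c i *: v i) ->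
  forall i, c i = bary v 0 i.

Hypotheses (beta_gt0 : forall i, 0 < bary v 0 i) (uniq : unique_interior).
Let beta i : R := bary v 0 i.

(** The weights [(E + 1) * beta i - e i] are positive, sum to 1 and represent the negative of the
    given lattice point. Uniqueness yields [e i = E * beta i], and [e j = 0] then forces [E = 0]. *)
Lemma small_comb_eq0 (J : {set 'I_d.+1}) (j : 'I_d.+1) (e : 'I_d.+1 -> R) : j \notin J ->
  (forall i, i \notin J -> e i = 0) -> lattice_pt (\sum_i e i *: v i) ->
  0 <= \sum_i e i ->
  (forall i, i \in J -> e i - (\sum_i e i) * beta i < beta i) -> forall i, e i = 0.
Proof.
move=> jJ e0 lat_e E0 small.
set E := \sum_i e i in E0 small.
pose c i := (E + 1) * beta i - e i.
have c1 : \sum_i c i = 1 by rewrite sumrB -mulr_sumr sum_bary // mulr1 /E addrC addKr.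
have cv : \sum_i c i *: v i = - \sum_i e i *: v i.
  under eq_bigr do rewrite scalerBl -scalerA.
  by rewrite sumrB -scaler_sumr baryE // scaler0 sub0r.
have c0 i : 0 < c i.
  rewrite /c; case: (boolP (i \in J)) => iJ; first by have := small i iJ; rewrite mulrDl mul1r; lra.
  by rewrite (e0 i iJ) subr0 mulr_gt0 // ltr_wpDl.
have lat_c : lattice_pt (\sum_i c i *: v i) by rewrite cv; apply: latticeN.
have H i : E * beta i = e i.
  by have := uniq c1 c0 lat_c i; rewrite /c -/(beta i) mulrDl mul1r; lra.
have E00 : E = 0.
  have := H j; rewrite e0 // => /eqP; rewrite mulf_eq0 (gt_eqF (beta_gt0 j)) orbF.
  by move/eqP.
by move=> i; rewrite -H E00 mul0r.
Qed.

(** [D] is the absolute determinant; it is integral as the sum of the integral numbers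
    [D * beta i]. *)
Lemma bary_denom : exists (D : nat) (b : 'I_d.+1 -> nat),
  [/\ (0 < D)%N, forall i, (b i)%:R = D%:R * beta i &
      forall z i, lattice_pt z -> int_val (D%:R * bary v z i)].
Proof.
have int_nat x : int_val x -> 0 <= x -> exists n : nat, x = n%:R :> R.
  by move=> [z ->] z0; exists `|z|%N; rewrite natr_absz intr_norm ger0_norm.
have det0 : \det (hom_mx v) != 0 by rewrite det_hom.
have [D DE] : exists n : nat, `|\det (hom_mx v)| = n%:R.
  apply: int_nat => //.
  have -> : `|\det (hom_mx v)| = \sum_i `|\det (hom_mx v)| * beta i.
    by rewrite -mulr_sumr sum_bary // mulr1.
  apply: int_val_sum => i _; apply: int_val_bary => // j.
  by exists 0; rewrite mxE.
have hb i : exists n : nat, n%:R = D%:R * beta i.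
  have [||n ->] := int_nat (D%:R * beta i); last by exists n.
    by rewrite -DE; apply: int_val_bary => // j; exists 0; rewrite mxE.
  by rewrite mulr_ge0 // ?ler0n // ltW ?beta_gt0.
have [b bE] := fin_all_exists hb.
exists D, b; split=> // [|z i hz]; last by rewrite -DE; apply: int_val_bary.
by rewrite -(ltr0n R) -DE normr_gt0.
Qed.

Section Denominators.
Variables (D : nat) (b : 'I_d.+1 -> nat).
Hypotheses (D_gt0 : (0 < D)%N) (bE : forall i, (b i)%:R = D%:R * beta i).
Variables (J : {set 'I_d.+1}) (j : 'I_d.+1).
Hypothesis jJ : j \notin J.

Let DR_gt0 : 0 < D%:R :> R. Proof. by rewrite ltr0n. Qed.

Lemma small_int_comb_eq0 (m : 'I_d.+1 -> int) : 0 <= \sum_(i in J) m i ->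
  (forall i, i \in J -> D%:Z * m i - (b i)%:Z * (\sum_(i in J) m i) < (b i)%:Z) ->
  forall i, i \in J -> m i = 0.
Proof.
move=> M0 small.
pose e i : R := if i \in J then (m i)%:~R else 0.
have eE : \sum_i e i = (\sum_(i in J) m i)%:~R.
  by rewrite rmorph_sum [RHS]big_mkcond.
have e0 : forall i, e i = 0.
  apply: (@small_comb_eq0 J j) => //.
  - by move=> i /negbTE iJ; rewrite /e iJ.
  - apply: lattice_sum => // i; rewrite /e; case: ifP => _; first exact: int_valz.
    exact: (int_valz _ 0).
  - by rewrite eE ler0z.
  - move=> i iJ; rewrite eE /e iJ -(ltr_pM2l DR_gt0) mulrBr mulrCA -bE.
    have := small i iJ; rewrite -(ltr_int R) rmorphB !rmorphM /= => h.
    by rewrite [X in _ - X]mulrC.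
by move=> i iJ; apply/eqP; have /eqP := e0 i; rewrite /e iJ intr_eq0.
Qed.

(** The bound on [y] is symmetric, and one of [m] and [- m] has nonnegative total, so
    [small_int_comb_eq0] applies to it. *)
Lemma no_small_vector : ~ small_vector J b D.
Proof.
move=> [y [[m mE] small [i iJ /eqP]]]; apply; rewrite mE //.
suff m0 : forall i, i \in J -> m i = 0 by rewrite m0 // big1 // !mulr0 subrr.
have {}small k : k \in J -> `|D%:Z * m k - (b k)%:Z * (\sum_(i in J) m i)| < (b k)%:Z.
  by move=> kJ; rewrite -mE ?small.
case: (lerP 0 (\sum_(i in J) m i)) => M0.
  apply: small_int_comb_eq0 => // k kJ.
  by apply: le_lt_trans (small k kJ); exact: ler_norm.
move=> k kJ; apply/eqP; rewrite -oppr_eq0; apply/eqP; move: k kJ.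
apply: (small_int_comb_eq0 (m := fun k => - m k)); rewrite sumrN.
  by rewrite oppr_ge0 ltW.
move=> k kJ; rewrite !mulrN opprK addrC.
by apply: le_lt_trans (small k kJ); rewrite distrC; exact: ler_norm.
Qed.

Let g := (\sum_(i | i \notin J) b i)%N.

Let b_gt0 i : (0 < b i)%N.
Proof. by rewrite -(ltr0n R) bE mulr_gt0. Qed.

Let g_gt0 : (0 < g)%N.
Proof. by rewrite /g (bigD1 j) //= ltn_addr. Qed.

Let DE : D = (\sum_(i in J) b i + g)%N.
Proof.
apply/eqP; rewrite -(eqr_nat R) natrD /g !natr_sum; apply/eqP.
rewrite -(@bigID _ _ _ _ _ (mem J) xpredT (fun i => (b i)%:R)) /=.
by under eq_bigr do rewrite bE; rewrite -mulr_sumr sum_bary // mulr1.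
Qed.

Lemma prod_bE : (\prod_(i in J) b i)%:R = D%:R ^+ #|J| * \prod_(i in J) beta i.
Proof. by rewrite natr_prod -prodr_const -big_split /=; apply: eq_bigr => i _; rewrite bE. Qed.

Lemma gDE i0 : i0 \in J ->
  (g * D ^ #|J|.-1)%:R = D%:R ^+ #|J| * \sum_(i | i \notin J) beta i.
Proof.
move=> i0J; rewrite natrM natrX natr_sum; under eq_bigr do rewrite bE.
by rewrite -mulr_sumr mulrAC -exprS prednK // (cardD1 i0) i0J.
Qed.

(** In units of [D ^+ #|J|] the two sides count the box points and the lattice classes. *)
Lemma prod_le_sum_denom i0 : i0 \in J ->
  \prod_(i in J) beta i <= \sum_(i | i \notin J) beta i.
Proof.
move=> i0J; rewrite leNgt; apply/negP => lt_ps; apply: no_small_vector.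
apply: (small_vector_exists i0J g_gt0 DE).
by rewrite -(ltr_nat R) prod_bE (gDE i0J) ltr_pM2l // exprn_gt0.
Qed.

Lemma box_cover_denom i0 : i0 \in J ->
  \prod_(i in J) beta i = \sum_(i | i \notin J) beta i ->
  forall y : 'I_d.+1 -> int, exists2 x : 'I_d.+1 -> int,
    (forall i, i \in J -> 0 <= x i < (b i)%:Z) & int_lat J b D (fun i => x i - y i).
Proof.
move=> i0J eq_ps; apply: (box_cover i0J g_gt0 DE) no_small_vector.
by apply/eqP; rewrite -(eqr_nat R) prod_bE (gDE i0J) eq_ps.
Qed.

End Denominators.

Lemma prod_bary_le_sum (J : {set 'I_d.+1}) i0 j : i0 \in J -> j \notin J ->
  \prod_(i in J) bary v 0 i <= \sum_(i | i \notin J) bary v 0 i.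
Proof.
move=> i0J jJ; have [D [b [D0 bE _]]] := bary_denom.
exact: (prod_le_sum_denom D0 bE jJ i0J).
Qed.

(** Equality makes the box over the complement of [j] meet every class. Write [z] with weights [c]
    vanishing at [j]; the covering supplies integers [m] such that [m + c] satisfies
    [small_comb_eq0], whence [c = - m] is integral. *)
Lemma lattice_generated j : (0 < d)%N ->
  \prod_(i | i != j) bary v 0 i = bary v 0 j ->
  forall z, lattice_pt z ->
    exists2 m : 'I_d.+1 -> int, m j = 0 & z = \sum_i (m i)%:~R *: v i.
Proof.
move=> d0 eq_pj z lat_z; have [D [b [D0 bE intD]]] := bary_denom.
pose J := [set~ j]; have jJ : j \notin J by rewrite !inE eqxx.
have [i0 i0J] : exists i0, i0 \in J.
  exists (if j == ord0 then ord_max else ord0); rewrite !inE.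
  have [->|] := eqVneq j ord0; last by rewrite eq_sym.
  by rewrite -val_eqE /= -lt0n.
have DR : 0 < D%:R :> R by rewrite ltr0n.
pose a i := bary v z i.
have [A AE] : exists A : 'I_d.+1 -> int, forall i, D%:R * a i = (A i)%:~R.
  exact: fin_all_exists (fun i => intD z i lat_z).
(* The shift by [b] matches the total weight 1 of [z]; it is what gives [x i] the form
   [D * (e i - (\sum e) * beta i)] below. *)
have [|x xb [m mE]] := @box_cover_denom D b D0 bE J j jJ i0 i0J _ (fun i => A i - (b i)%:Z).
  rewrite [RHS](big_pred1 j) => [|i]; last by rewrite !inE negbK.
  by rewrite -[RHS]eq_pj; apply: eq_bigl => i; rewrite !inE.
(* Subtracting [q * beta] cancels the weight at [j] without moving the point, since [beta]
   represents 0. *)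
pose q := a j / beta j.
pose c i := a i - q * beta i.
have cj : c j = 0 by rewrite /c /q divfK ?subrr // gt_eqF.
have cv : \sum_i c i *: v i = z.
  under eq_bigr do rewrite scalerBl -scalerA.
  by rewrite sumrB -scaler_sumr !baryE // scaler0 subr0.
have cs : \sum_i c i = 1 - q by rewrite sumrB -mulr_sumr !sum_bary // mulr1.
pose mR i : R := if i \in J then (m i)%:~R else 0.
have mRj : mR j = 0 by rewrite /mR (negbTE jJ).
pose e i := mR i + c i.
have ms : \sum_i mR i = (\sum_(i in J) m i)%:~R.
  by rewrite rmorph_sum [RHS]big_mkcond.
have xE i : i \in J -> (x i)%:~R = D%:R * (e i - (\sum_i e i) * beta i).
  move=> iJ; have /(congr1 (fun z : int => z%:~R : R)) := mE i iJ.
  rewrite !rmorphB !rmorphM /= -ms -AE -!pmulrn !bE => h.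
  have -> : (x i)%:~R = D%:R * a i - D%:R * beta i + (D%:R * mR i - D%:R * beta i * \sum_i mR i).
    by rewrite /mR iJ -h; ring.
  by rewrite /e big_split /= cs /c; ring.
(* The entries of [x] over [J] are nonnegative and add up to [D * beta j * \sum e]. *)
have es0 : 0 <= \sum_i e i.
  have : 0 <= \sum_(i in J) (x i)%:~R :> R.
    by apply: sumr_ge0 => i iJ; have /andP[] := xb i iJ; rewrite ler0z.
  rewrite (eq_bigr _ xE) -mulr_sumr pmulr_rge0 // sumrB -mulr_sumr.
  have -> : \sum_(i in J) e i = \sum_i e i.
    by rewrite [RHS](bigD1 j) //= /e mRj cj !add0r; apply: eq_bigl => i; rewrite !inE.
  have -> : \sum_(i in J) beta i = 1 - beta j.
    rewrite -(sum_bary nondeg 0) [X in _ = X - _](bigD1 j) //= addrAC subrr add0r.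
    by apply: eq_bigl => i; rewrite !inE.
  by rewrite mulrBr mulr1 opprB addrC subrK pmulr_lge0 // beta_gt0.
have e0 : forall i, e i = 0.
  apply: (small_comb_eq0 jJ) => // [i||i iJ].
  - by rewrite !inE ?negbK => /eqP->; rewrite /e mRj cj addr0.
  - under eq_bigr do rewrite scalerDl.
    rewrite big_split /= cv; apply: latticeD => //; apply: lattice_sum => // i.
    by rewrite /mR; case: ifP => _; [exact: int_valz | exact: (int_valz _ 0)].
  - rewrite -(ltr_pM2l DR) -xE // -bE.
    by have /andP[_] := xb i iJ; rewrite -(ltr_int R).
exists (fun i => if i \in J then - m i else 0); first by rewrite (negbTE jJ).
rewrite -cv; apply: eq_bigr => i _; congr (_ *: _).
have := e0 i; rewrite /e /mR; case: (i \in J); last by rewrite add0r.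
by rewrite rmorphN /=; lra.
Qed.

End OneInteriorPoint.

(** * Polar simplices and the volume product *)

Section Hulls.
Variables (R : realFieldType) (d : nat).
Implicit Types (v w u : 'I_d.+1 -> 'rV[R]_d) (s : 'S_d.+1).

Lemma convhull_bary v x : simplex_nondeg v ->
  convhull v x <-> forall i, 0 <= bary v x i.
Proof.
move=> nv; split=> [[c [c0 [c1 ->]]] i|x0]; first by rewrite bary_uniq.
by exists (bary v x); rewrite sum_bary ?baryE.
Qed.

Lemma bary_vertex v i k : simplex_nondeg v -> bary v (v i) k = (k == i)%:R.
Proof.
move=> nv; rewrite -(bary_uniq nv (c := fun k => (k == i)%:R)).
  rewrite (bigD1 i) //= eqxx scale1r big1 ?addr0 // => j /negbTE->; exact: scale0r.
by rewrite (bigD1 i) //= eqxx big1 ?addr0 // => j /negbTE->.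
Qed.

(** Vertices are extreme points: in a convex expression of [v i] by the [w j], any [w j] of nonzero
    weight has zero coordinates off [i], so it equals [v i]. *)
Lemma convhull_perm v w : simplex_nondeg v ->
  (forall y, convhull w y <-> convhull v y) -> exists s, forall i, w (s i) = v i.
Proof.
move=> nv hwv.
have vertex (u : 'I_d.+1 -> 'rV[R]_d) j : convhull u (u j).
  exists (fun k => (k == j)%:R); split=> [k|]; first exact: ler0n.
  split; rewrite (bigD1 j) //= eqxx big1 ?addr0 ?scale1r // => k /negbTE-> //.
  exact: scale0r.
have L0 j k : 0 <= bary v (w j) k by have /hwv/(convhull_bary _ nv) := vertex w j; apply.
have f_ex i : exists j, w j = v i.
  have [M [M0 [M1 ME]]] := (hwv (v i)).2 (vertex v i).
  have [j Mj] : exists j, M j != 0.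
    case: (pickP (fun j => M j != 0)) => [j Mj|M_eq0]; first by exists j.
    have := oner_neq0 R; rewrite -M1 big1 ?eqxx // => j _.
    exact/eqP/negbFE/M_eq0.
  have MLE k : \sum_j M j * bary v (w j) k = (k == i)%:R.
    rewrite -(bary_vertex i k nv) ME.
    have -> : \sum_j M j *: w j = \sum_k (\sum_j M j * bary v (w j) k) *: v k.
      rewrite (eq_bigr (fun j => \sum_k (M j * bary v (w j) k) *: v k)).
        by rewrite exchange_big; apply: eq_bigr => l _; rewrite scaler_suml.
      move=> l _; rewrite -[in LHS](baryE nv (w l)) scaler_sumr.
      by apply: eq_bigr => m _; rewrite scalerA.
    rewrite bary_uniq // exchange_big /= -[RHS]M1; apply: eq_bigr => l _.
    by rewrite -mulr_sumr sum_bary ?mulr1.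
  have Lk k : k != i -> bary v (w j) k = 0.
    move=> /negbTE ki; have := MLE k; rewrite ki => /eqP.
    rewrite psumr_eq0 => [/allP/(_ j)|l _]; last by rewrite mulr_ge0.
    by rewrite mem_index_enum /= mulf_eq0 (negbTE Mj) => /(_ isT)/eqP.
  have Li : bary v (w j) i = 1.
    by rewrite -(sum_bary nv (w j)) (bigD1 i) //= big1 ?addr0.
  exists j; rewrite -[LHS](baryE nv) (bigD1 i) //= Li scale1r big1 ?addr0 // => k /Lk->.
  exact: scale0r.
have [f fE] := fin_all_exists f_ex.
have f_inj : injective f.
  move=> i k eqf; have : bary v (v i) k = 1 by rewrite -fE eqf fE bary_vertex ?eqxx.
  by rewrite bary_vertex // eq_sym; case: eqP => // _ /eqP; rewrite eq_sym oner_eq0.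
by exists (perm f_inj) => i; rewrite permE.
Qed.

(** The homogeneous matrix treats all vertices alike, so a permutation only permutes its rows. *)
Lemma det_edge_perm v s : `|\det (edge_mx (fun i => v (s i)))| = `|\det (edge_mx v)|.
Proof.
rewrite -!det_hom (_ : hom_mx _ = perm_mx s *m hom_mx v).
  by rewrite det_mulmx det_perm normrM normrX normrN1 expr1n mul1r.
by rewrite -row_permE; apply/matrixP => i j; rewrite !mxE.
Qed.

Lemma nondeg_perm v s : simplex_nondeg v -> simplex_nondeg (fun i => v (s i)).
Proof. by rewrite /simplex_nondeg -!normr_gt0 det_edge_perm. Qed.

Lemma bary_perm v s i : simplex_nondeg v -> bary (fun i => v (s i)) 0 i = bary v 0 (s i).
Proof.
move=> nv.
have E : \sum_i bary v 0 (s i) *: v (s i) = 0.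
  rewrite -(reindex_inj (h := s) (P := xpredT) (F := fun i => bary v 0 i *: v i)) ?baryE //.
  exact: perm_inj.
rewrite -[in LHS]E (bary_uniq (nondeg_perm s nv)) //.
rewrite -(reindex_inj (h := s) (P := xpredT) (F := fun i => bary v 0 i)) ?sum_bary //.
exact: perm_inj.
Qed.

Lemma dotp_suml (I : finType) (c : I -> R) (a : I -> 'rV[R]_d) y :
  dotp (\sum_i c i *: a i) y = \sum_i c i * dotp (a i) y.
Proof.
rewrite /dotp; under [RHS]eq_bigr do rewrite mulr_sumr.
rewrite exchange_big; apply: eq_bigr => j _; rewrite summxE mulr_suml.
by apply: eq_bigr => i _; rewrite mxE mulrA.
Qed.

Lemma dotpC (x y : 'rV[R]_d) : dotp x y = dotp y x.
Proof. by apply: eq_bigr => j _; rewrite mulrC. Qed.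

Section Polar.
Variable v : 'I_d.+1 -> 'rV[R]_d.
Hypotheses (nv : simplex_nondeg v) (beta_gt0 : forall i, 0 < bary v 0 i).

(** Column [i] of the inverse homogeneous matrix, scaled so that its top entry is -1 and then
    stripped of it: the point where [dotp (v j)] equals 1 for every [j] other than [i]. *)
Definition polar_vert i : 'rV[R]_d :=
  \row_k - (invmx (hom_mx v) (lift ord0 k) i / bary v 0 i).

Lemma bary0E i : bary v 0 i = invmx (hom_mx v) ord0 i.
Proof.
rewrite /bary mxE big_ord_recl hom_rowE0 mul1r big1 ?addr0 // => k _.
by rewrite hom_rowES mxE mul0r.
Qed.

Lemma dotp_polar_vert j i :
  dotp (v j) (polar_vert i) = 1 - (j == i)%:R / bary v 0 i.
Proof.
have := mulmxV (hom_unit nv) => /matrixP/(_ j i); rewrite !mxE big_ord_recl hom_mxE0 mul1r -bary0E.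
under eq_bigr do rewrite hom_mxES.
move=> <-; rewrite mulrDl divff ?gt_eqF // opprD addrA subrr sub0r mulr_suml -sumrN.
by apply: eq_bigr => k _; rewrite mxE mulrN mulrA.
Qed.

Lemma eq_dotp x y : (forall j, dotp (v j) x = dotp (v j) y) -> x = y.
Proof.
have dotp_delta k z : dotp (delta_mx ord0 k) z = z ord0 k.
  rewrite /dotp (bigD1 k) //= mxE !eqxx mul1r big1 ?addr0 // => l /negbTE lk.
  by rewrite mxE lk andbF mul0r.
move=> h; apply/rowP => k; rewrite -!dotp_delta -(baryE nv (delta_mx _ _)) !dotp_suml.
by apply: eq_bigr => i _; rewrite h.
Qed.

Lemma dotp_polar_comb j (mu : 'I_d.+1 -> R) : \sum_i mu i = 1 ->
  dotp (v j) (\sum_i mu i *: polar_vert i) = 1 - mu j / bary v 0 j.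
Proof.
move=> mu1; rewrite dotpC dotp_suml.
under eq_bigr do rewrite dotpC dotp_polar_vert mulrBr mulr1.
rewrite sumrB mu1 (bigD1 j) //= eqxx mul1r big1 ?addr0 // => i ij.
by rewrite eq_sym (negbTE ij) mul0r mulr0.
Qed.

Lemma polar_hull y : convhull polar_vert y <-> polar_body (convhull v) y.
Proof.
split=> [[mu [mu0 [mu1 ->]]] x [lam [lam0 [lam1 ->]]]|hy].
  rewrite dotp_suml -lam1; apply: ler_sum => j _.
  rewrite dotp_polar_comb // mulrBr mulr1 gerBl mulr_ge0 // divr_ge0 //.
  exact/ltW/beta_gt0.
(* The weights are obtained by solving [dotp_polar_comb] for [mu]; they sum to 1 because [beta]
   represents the origin. *)
pose mu i := bary v 0 i * (1 - dotp (v i) y).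
have mu1 : \sum_i mu i = 1.
  under eq_bigr do rewrite /mu mulrBr mulr1.
  rewrite sumrB sum_bary // -dotp_suml baryE // /dotp big1 ?subr0 // => k _.
  by rewrite mxE mul0r.
exists mu; split=> [i|].
  rewrite mulr_ge0 ?(ltW (beta_gt0 _)) // subr_ge0; apply: hy.
  exists (fun k => (k == i)%:R); split=> [k|]; first exact: ler0n.
  split; rewrite (bigD1 i) //= eqxx big1 ?addr0 ?scale1r // => k /negbTE-> //.
  exact: scale0r.
split=> //; apply: eq_dotp => j.
by rewrite dotp_polar_comb // /mu mulrAC divff ?gt_eqF // mul1r opprB addrC subrK.
Qed.

(** Negating the polar vertices turns the product of one homogeneous matrix with the transpose of
    the other into the entries [1 - dotp (v j) (polar_vert i)], a diagonal matrix. *)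
Lemma det_polar :
  `|\det (edge_mx v)| * `|\det (edge_mx polar_vert)| = (\prod_i bary v 0 i)^-1.
Proof.
have -> : `|\det (edge_mx polar_vert)| = `|\det (edge_mx (fun i => - polar_vert i))|.
  have -> : edge_mx (fun i => - polar_vert i) = -1 *: edge_mx polar_vert.
    by apply/matrixP => i k; rewrite !mxE; ring.
  by rewrite detZ normrM normrX normrN1 expr1n mul1r.
rewrite -!det_hom -normrM -[X in _ * X]det_tr -det_mulmx.
have -> : hom_mx v *m (hom_mx (fun i => - polar_vert i))^T = diag_mx (\row_i (bary v 0 i)^-1).
  apply/matrixP => j i; rewrite mxE big_ord_recl hom_mxE0 [_^T _ _]mxE hom_mxE0 mul1r.
  transitivity (1 - dotp (v j) (polar_vert i)).
    congr (1 + _); rewrite -sumrN; apply: eq_bigr => k _.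
    by rewrite hom_mxES [_^T _ _]mxE hom_mxES !mxE mulrN.
  by rewrite dotp_polar_vert opprB addrC subrK !mxE mulr_natl; case: eqP => [->|].
rewrite det_diag; under eq_bigr do rewrite mxE.
by rewrite -prodfV ger0_norm // prodr_ge0 // => i _; rewrite invr_ge0 ltW.
Qed.

Lemma nondeg_polar : simplex_nondeg polar_vert.
Proof.
have : 0 < (\prod_i bary v 0 i)^-1 by rewrite invr_gt0 prodr_gt0.
rewrite -det_polar /simplex_nondeg; case: eqP => // ->.
by rewrite normr0 mulr0 ltxx.
Qed.

(** By [convhull_perm], [w] is a reordering of the polar vertices, so its volume is theirs. *)
Lemma volume_product w : (forall y, convhull w y <-> polar_body (convhull v) y) ->
  (d`!)%:R ^+ 2 * simplex_vol v * simplex_vol w = (\prod_i bary v 0 i)^-1.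
Proof.
move=> hw.
have [s sE] : exists s : 'S_d.+1, forall i, w (s i) = polar_vert i.
  apply: (convhull_perm nondeg_polar) => y.
  by split=> [/hw/polar_hull|/polar_hull/hw].
rewrite -det_polar -(_ : edge_mx (fun i => w (s i)) = edge_mx polar_vert); last first.
  by apply/row_matrixP => i; rewrite !rowK !sE.
rewrite det_edge_perm /simplex_vol.
have : (d`!)%:R != 0 :> R by rewrite pnatr_eq0 -lt0n fact_gt0.
by move=> h; field.
Qed.

End Polar.
End Hulls.

(** * The Sylvester simplex and unimodular equivalence *)

Section SylvesterSimplex.
Variables (R : realFieldType) (d : nat).

(* [Tvert] puts the origin first, while [sylv_bary] lists its weight [1/(s_(d+1) - 1)] last. *)
Definition vertex_rot (i : 'I_d.+1) : 'I_d.+1 :=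
  if unlift ord0 i is Some k then widen_ord (leqnSn d) k else ord_max.

Lemma vertex_rot_inj : injective vertex_rot.
Proof.
move=> i j; rewrite /vertex_rot.
case: unliftP => [k|] ->; case: unliftP => [l|] -> // /(congr1 val) /= e.
- by congr lift; apply: val_inj.
- by have := ltn_ord k; rewrite e ltnn.
- by have := ltn_ord l; rewrite -e ltnn.
Qed.

Definition T_bary (i : 'I_d.+1) : R := sylv_bary R d (vertex_rot i).

Lemma T_bary0 : T_bary ord0 = (sylvP d)%:R^-1.
Proof. by rewrite /T_bary /vertex_rot unlift_none /sylv_bary /= ltnn. Qed.

Lemma T_baryS k : T_bary (lift ord0 k) = (sylv k.+1)%:R^-1.
Proof. by rewrite /T_bary /vertex_rot liftK /sylv_bary /= ltn_ord. Qed.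

Lemma T_bary_gt0 i : 0 < T_bary i.
Proof. exact: sylv_bary_gt0. Qed.

Lemma sum_T_bary : \sum_i T_bary i = 1.
Proof.
rewrite -[RHS](sum_sylv_baryT R d) [RHS](reindex_inj vertex_rot_inj).
exact: eq_bigr.
Qed.

Lemma prod_T_bary : \prod_i T_bary i = (sylvP d)%:R ^- 2.
Proof.
rewrite -[RHS](prod_sylv_baryT R d) [RHS](reindex_inj vertex_rot_inj).
exact: eq_bigr.
Qed.

Lemma Tvert0 : Tvert R (ord0 : 'I_d.+1) = 0.
Proof. by rewrite /Tvert unlift_none. Qed.

Lemma TvertS (k : 'I_d) : Tvert R (lift ord0 k) = (sylv k.+1)%:R *: delta_mx ord0 k.
Proof. by rewrite /Tvert liftK. Qed.

Lemma Tvert_comb (c : 'I_d.+1 -> R) k :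
  (\sum_i c i *: Tvert R i) ord0 k = c (lift ord0 k) * (sylv k.+1)%:R.
Proof.
rewrite summxE big_ord_recl Tvert0 mxE mxE mulr0 add0r (bigD1 k) //= TvertS !mxE !eqxx mulr1.
by rewrite big1 ?addr0 // => l lk; rewrite TvertS !mxE eqxx (eq_sym k) (negbTE lk) !mulr0.
Qed.

Lemma sylv_gt0 k : 0 < (sylv k)%:R :> R.
Proof. by rewrite ltr0n /sylv addn1. Qed.

Lemma sylv_le k : (k < d)%N -> (sylv k.+1 <= sylvP d)%N.
Proof.
move=> kd; apply: (@leq_trans (sylvP k.+1)).
  by rewrite /sylv /= leq_pmull // sylvP_gt0.
move: kd; elim: d => // n IH; rewrite ltnS leq_eqVlt => /orP[/eqP->//|/IH/leq_trans]; apply.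
by rewrite /= leq_pmulr // addn1.
Qed.

(** Each weight off the origin vertex is a positive integer over [sylv k.+1]. A numerator of 2 or
    more adds at least [1 / sylvP d], which is all that is left for the origin vertex. *)
Lemma T_bary_unique (c : 'I_d.+1 -> R) : \sum_i c i = 1 -> (forall i, 0 < c i) ->
  lattice_pt (\sum_i c i *: Tvert R i) -> forall i, c i = T_bary i.
Proof.
move=> c1 c0 lat.
have zE k : exists2 z : int, 1 <= z & c (lift ord0 k) = z%:~R / (sylv k.+1)%:R.
  have [z] := lat k; rewrite Tvert_comb => e; exists z.
    by rewrite -gtz0_ge1 -(ltr_int R) -e mulr_gt0 ?sylv_gt0.
  by rewrite -e mulfK // gt_eqF ?sylv_gt0.
have ge k : T_bary (lift ord0 k) <= c (lift ord0 k).
  have [z z1 ->] := zE k; rewrite T_baryS ler_peMl ?ler1z // invr_ge0.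
  exact/ltW/sylv_gt0.
have eqS k : c (lift ord0 k) = T_bary (lift ord0 k).
  apply/eqP; rewrite eq_le ge andbT leNgt; apply/negP => lt_k.
  have gap : T_bary (lift ord0 k) + T_bary ord0 <= c (lift ord0 k).
    have [z z1 cE] := zE k; move: lt_k; rewrite cE T_baryS T_bary0.
    rewrite -[X in X < _]mul1r ltr_pM2r ?invr_gt0 ?sylv_gt0 // -[1]/(1%:~R) ltr_int => lt1z.
    apply: (@le_trans _ _ (2%:R / (sylv k.+1)%:R)).
      rewrite mulr_natl mulr2n lerD2l lef_pV2 ?posrE ?sylv_gt0 ?ltr0n ?sylvP_gt0 //.
      by rewrite ler_nat sylv_le.
    rewrite ler_pM2r ?invr_gt0 ?sylv_gt0 //.
    by rewrite -[2%:R]/(2%:~R) ler_int.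
  have : \sum_i T_bary i <= \sum_(i < d) c (lift ord0 i).
    rewrite sum_T_bary -sum_T_bary big_ord_recl (bigD1 k) //= [leRHS](bigD1 k) //=.
    by rewrite addrA lerD // 1?addrC // ler_sum.
  by rewrite sum_T_bary -c1 big_ord_recl gerDr leNgt c0.
move=> i; case: (unliftP ord0 i) => [k|] -> //.
have := c1; rewrite -sum_T_bary !big_ord_recl (eq_bigr _ (fun k _ => eqS k)).
exact: addIr.
Qed.

Lemma nondeg_Tvert : simplex_nondeg (@Tvert R d).
Proof.
rewrite /simplex_nondeg (_ : edge_mx _ = diag_mx (\row_k (sylv k.+1)%:R)).
  rewrite det_diag; apply/prodf_neq0 => k _; rewrite mxE gt_eqF ?sylv_gt0 //.
apply/matrixP => k l; rewrite !mxE Tvert0 TvertS !mxE eqxx subr0 eq_sym.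
by case: eqP => [->|_]; rewrite ?mulr1 ?mulr0.
Qed.

(** The translate that moves the interior lattice point (1, ..., 1) of the Sylvester simplex to the
    origin. *)
Definition Tcenter (i : 'I_d.+1) : 'rV[R]_d := Tvert R i - const_mx 1.

Lemma nondeg_Tcenter : simplex_nondeg Tcenter.
Proof.
rewrite /simplex_nondeg (_ : edge_mx _ = edge_mx (@Tvert R d)); first exact: nondeg_Tvert.
by apply/matrixP => i j; rewrite !mxE; ring.
Qed.

Lemma lattice_one : lattice_pt (const_mx 1 : 'rV[R]_d).
Proof. by move=> j; exists 1; rewrite mxE. Qed.

Lemma lattice_Tcenter i : lattice_pt (Tcenter i).
Proof.
apply: latticeD; last exact/latticeN/lattice_one.
case: (unliftP ord0 i) => [k|] ->; rewrite ?Tvert0 ?TvertS => j; rewrite !mxE; last by exists 0.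
by apply: int_valM; [exists (sylv k.+1)%:Z|exists ((ord0 == ord0 :> 'I_1) && (j == k))%:Z].
Qed.

Lemma Tcenter_comb (c : 'I_d.+1 -> R) : \sum_i c i = 1 ->
  \sum_i c i *: Tcenter i = \sum_i c i *: Tvert R i - const_mx 1.
Proof.
move=> c1; under eq_bigr do rewrite scalerBr.
by rewrite sumrB -scaler_suml c1 scale1r.
Qed.

Lemma bary_Tcenter i : bary Tcenter 0 i = T_bary i.
Proof.
have -> : 0 = \sum_i T_bary i *: Tcenter i.
  rewrite Tcenter_comb ?sum_T_bary //; apply/esym/eqP; rewrite subr_eq0.
  by apply/eqP/rowP => k; rewrite Tvert_comb T_baryS mxE mulVf ?gt_eqF ?sylv_gt0.
by rewrite bary_uniq ?sum_T_bary //; exact: nondeg_Tcenter.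
Qed.

Lemma unique_Tcenter : unique_interior Tcenter.
Proof.
move=> c c1 c0 lat i; rewrite bary_Tcenter; apply: T_bary_unique => //.
have -> : \sum_i c i *: Tvert R i = \sum_i c i *: Tcenter i + const_mx 1.
  by rewrite Tcenter_comb // subrK.
exact/latticeD/lattice_one.
Qed.

End SylvesterSimplex.

Section Equivalence.
Variables (R : realFieldType) (d : nat).
Implicit Types (v u : 'I_d.+1 -> 'rV[R]_d) (s : 'S_d.+1).

Definition generates v : Prop := forall z, lattice_pt z ->
  exists m : 'I_d.+1 -> int, z = \sum_i (m i)%:~R *: v i.

(** Cancelling the weight [1 / sylvP d] of [j] from the total product leaves [1 / sylvP d], the
    equality required by [lattice_generated]. *)
Lemma generates_sylv v j : (forall i, lattice_pt (v i)) -> simplex_nondeg v ->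
  (forall i, 0 < bary v 0 i) -> unique_interior v ->
  bary v 0 j = (sylvP d)%:R^-1 -> \prod_i bary v 0 i = (sylvP d)%:R ^- 2 -> generates v.
Proof.
move=> lv nv b0 uv bj pb z lz.
(* In dimension 0 there is no second vertex, but 0 is the only point. *)
have [d0|d0] := posnP d.
  exists (fun=> 0); rewrite big1 => [|i _]; last by rewrite scale0r.
  by apply/rowP => k; have := ltn_ord k; rewrite [X in (_ < X)%N]d0.
have [|m _ ->] := lattice_generated lv nv b0 uv (j := j) d0 _ lz; last by exists m.
have := pb; rewrite (bigD1 j) //= bj expr2 invfM; apply: mulfI.
by rewrite invr_eq0 pnatr_eq0 -lt0n sylvP_gt0.
Qed.

Lemma generates_perm v s : generates v -> generates (fun i => v (s i)).
Proof.
move=> gv z /gv[m ->]; exists (fun i => m (s i)).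
by rewrite (reindex_inj (@perm_inj _ s)).
Qed.

(** [F] is the affine map carrying [v] to [u] in homogeneous form; its translation row is the image
    of the origin, which vanishes by assumption. *)
Lemma linear_map_exists v u : simplex_nondeg v ->
  \sum_i bary v 0 i *: u i = 0 -> exists A : 'M[R]_d, forall i, v i *m A = u i.
Proof.
move=> nv sum0; pose F := invmx (hom_mx v) *m hom_mx u.
have F0 k : F ord0 (lift ord0 k) = 0.
  have /rowP/(_ k) := sum0; rewrite summxE [RHS]mxE; apply: etrans; rewrite mxE.
  by apply: eq_bigr => i _; rewrite hom_mxES mxE bary0E.
exists (\matrix_(l, k) F (lift ord0 l) (lift ord0 k)) => i; apply/rowP => k.
rewrite -hom_mxES -(mulKVmx (hom_unit nv) (hom_mx u)) -/F [RHS]mxE big_ord_recl F0 mulr0 add0r mxE.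
by apply: eq_bigr => l _; rewrite hom_mxES mxE.
Qed.

(** Equal weights at the origin give mutually inverse linear maps between the vertices. Since the
    vertices generate the lattice on both sides, each map preserves it. *)
Lemma unimod_equiv_of_bary v u t : simplex_nondeg v -> simplex_nondeg u ->
  (forall i, lattice_pt (v i)) -> (forall i, lattice_pt (u i)) -> lattice_pt t ->
  (forall i, bary v 0 i = bary u 0 i) -> generates v -> generates u ->
  unimod_equiv (convhull v) (convhull (fun i => u i + t)).
Proof.
move=> nv nu lv lu lt eb gv gu.
have [|A vA] := @linear_map_exists v u nv.
  by under eq_bigr do rewrite eb; rewrite baryE.
have [|B uB] := @linear_map_exists u v nu.
  by under eq_bigr do rewrite -eb; rewrite baryE.
have combA (c : 'I_d.+1 -> R) : (\sum_i c i *: v i) *m A = \sum_i c i *: u i.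
  by rewrite mulmx_suml; apply: eq_bigr => i _; rewrite -scalemxAl vA.
have combB (c : 'I_d.+1 -> R) : (\sum_i c i *: u i) *m B = \sum_i c i *: v i.
  by rewrite mulmx_suml; apply: eq_bigr => i _; rewrite -scalemxAl uB.
have AB (x : 'rV[R]_d) : x *m A *m B = x by rewrite -(baryE nv x) combA combB.
exists A, t; split; last split.
- have : A *m B = 1%:M.
    by apply/row_matrixP => i; rewrite !rowE mulmxA AB mulmx1.
  by case/mulmx1_unit.
- move=> x; split=> [/gv[m ->]|lx].
    rewrite combA; apply: latticeD => //; apply: lattice_sum => // i; exact: int_valz.
  rewrite -(AB x); have /gu[m ->] : lattice_pt (x *m A).
    by rewrite -(addrK t (x *m A)); apply: latticeD => //; apply: latticeN.
  by rewrite combB; apply: lattice_sum => // i; exact: int_valz.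
have combt (c : 'I_d.+1 -> R) : \sum_i c i = 1 ->
    \sum_i c i *: (u i + t) = (\sum_i c i *: v i) *m A + t.
  move=> c1; rewrite combA; under eq_bigr do rewrite scalerDr.
  by rewrite big_split /= -scaler_suml c1 scale1r.
move=> y; split=> [[c [c0 [c1 ->]]]|[x [[c [c0 [c1 ->]]] ->]]].
  by exists (\sum_i c i *: v i); split; [exists c | exact: combt].
by exists c; rewrite combt.
Qed.

Lemma convhull_reindex v s y : convhull v y <-> convhull (fun i => v (s i)) y.
Proof.
split=> -[c [c0 [c1 ->]]].
  exists (fun i => c (s i)); split=> //; split.
    by rewrite -c1 [RHS](reindex_inj (@perm_inj _ s)).
  by rewrite (reindex_inj (@perm_inj _ s)).
exists (fun i => c ((s^-1)%g i)); split=> //; split.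
  by rewrite -c1 [RHS](reindex_inj (@perm_inj _ (s^-1)%g)).
rewrite (reindex_inj (@perm_inj _ (s^-1)%g)) /=.
by apply: eq_bigr => i _; rewrite permKV.
Qed.

(** Match the permuted [v] with [Tcenter], which also has the origin as interior lattice point, and
    then translate by the all-ones vector. *)
Lemma unimod_equivT v s : simplex_nondeg v -> (forall i, lattice_pt (v i)) ->
  generates v -> (forall i, bary v 0 (s i) = T_bary R i) ->
  unimod_equiv (convhull v) (@Tsimplex R d).
Proof.
move=> nv lv gv bs.
have gT : generates (@Tcenter R d).
  apply: (@generates_sylv _ ord0); rewrite ?bary_Tcenter ?T_bary0 //.
  - exact: lattice_Tcenter.
  - exact: nondeg_Tcenter.
  - by move=> i; rewrite bary_Tcenter T_bary_gt0.
  - exact: unique_Tcenter.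
  - by rewrite -prod_T_bary; apply: eq_bigr => i _; rewrite bary_Tcenter.
have [A [t [uA [latA hullA]]]] : unimod_equiv (convhull (fun i => v (s i)))
    (convhull (fun i => Tcenter R i + const_mx 1)).
  apply: unimod_equiv_of_bary => //.
  - exact: nondeg_perm.
  - exact: nondeg_Tcenter.
  - exact: lattice_Tcenter.
  - exact: lattice_one.
  - by move=> i; rewrite bary_perm // bary_Tcenter.
  - exact: generates_perm.
have TE y : Tsimplex y <-> convhull (fun i => Tcenter R i + const_mx 1) y.
  by split=> -[c [c0 [c1 ->]]]; exists c; split=> //; split=> //; apply: eq_bigr => i _;
    rewrite subrK.
exists A, t; split=> //; split=> // y; rewrite TE hullA.
by split=> -[x [hx ->]]; exists x; split=> //; apply/(convhull_reindex v s).
Qed.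

(** The map sends vertices to vertices up to order and 0 to the lattice point [t], which keeps its
    positive weights; [T_bary_unique] identifies them. *)
Lemma bary_of_unimod_equivT v : simplex_nondeg v ->
  (forall i, 0 < bary v 0 i) -> unimod_equiv (convhull v) (@Tsimplex R d) ->
  exists s, forall i, bary v 0 (s i) = T_bary R i.
Proof.
move=> nv b0 [A [t [_ [latA hullA]]]].
have comb (c : 'I_d.+1 -> R) : \sum_i c i = 1 ->
    \sum_i c i *: (v i *m A + t) = (\sum_i c i *: v i) *m A + t.
  move=> c1; under eq_bigr do rewrite scalerDr scalemxAl.
  by rewrite big_split /= -scaler_suml c1 scale1r mulmx_suml.
have [s sE] : exists s, forall i, v (s i) *m A + t = Tvert R i.
  apply: (convhull_perm (w := fun i => v i *m A + t) (@nondeg_Tvert R d)) => y.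
  rewrite -/(Tsimplex y) hullA; split=> [[c [c0 [c1 ->]]]|[x [[c [c0 [c1 ->]]] ->]]].
    by exists (\sum_i c i *: v i); split; [exists c | exact: comb].
  by exists c; rewrite comb.
exists s; apply: T_bary_unique => //.
  by rewrite -(sum_bary nv 0) [RHS](reindex_inj (@perm_inj _ s)).
under eq_bigr do rewrite -sE.
rewrite -(reindex_inj (h := s) (P := xpredT) (F := fun i => bary v 0 i *: (v i *m A + t))).
  rewrite comb ?sum_bary // baryE //; by apply: (latA 0).1 => j; exists 0; rewrite mxE.
exact: perm_inj.
Qed.

End Equivalence.

(** * Sorting the barycentric coordinates and bounding their product *)

Lemma sort_ord_perm (R : realFieldType) (n : nat) (f : 'I_n.+1 -> R) :
  exists s : 'S_n.+1, forall i, (i < n)%N -> f (s (inord i.+1)) <= f (s (inord i)).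
Proof.
pose e : rel 'I_n.+1 := fun a b => f b <= f a.
have e_total : total e by move=> a b; rewrite /e le_total.
have /tuple_permP[p pE] : perm_eq (sort e (enum 'I_n.+1)) (ord_tuple n.+1).
  by rewrite perm_sort.
exists p => i lt_in.
have nthE k : (k <= n)%N -> nth ord0 (sort e (enum 'I_n.+1)) k = p (inord k).
  move=> kn; rewrite pE /= (nth_map ord0) ?size_enum_ord //.
  rewrite tnth_ord_tuple; congr (p _).
  by apply: val_inj; rewrite /= nth_enum_ord // inordK.
have /(sortedP ord0)/(_ i) := sort_sorted e_total (enum 'I_n.+1).
by rewrite size_sort size_enum_ord ltnS lt_in => /(_ isT); rewrite !nthE // ltnW.
Qed.

Section UpperBound.
Variables (R : realFieldType) (d : nat) (v : 'I_d.+1 -> 'rV[R]_d).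
Hypotheses (lv : forall i, lattice_pt (v i)) (nv : simplex_nondeg v).
Hypotheses (b0 : forall i, 0 < bary v 0 i) (uv : unique_interior v).

Lemma prod_bary_ge : (sylvP d)%:R ^- 2 <= \prod_i bary v 0 i /\
  ((sylvP d)%:R ^- 2 = \prod_i bary v 0 i ->
   exists s : 'S_d.+1, forall i, bary v 0 (s i) = sylv_bary R d i).
Proof.
have [s sdec] := sort_ord_perm (bary v 0).
pose x n := bary v 0 (s (inord n)).
have sumE : \sum_(i < d.+1) x i = 1.
  rewrite -(sum_bary nv 0) [RHS](reindex_inj (@perm_inj _ s)).
  by apply: eq_bigr => i _; rewrite /x inord_val.
have prodE : \prod_(i < d.+1) x i = \prod_i bary v 0 i.
  rewrite [RHS](reindex_inj (@perm_inj _ s)).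
  by apply: eq_bigr => i _; rewrite /x inord_val.
have [||//|j jd|h1 h2] := @prod_ge_sylv R x d.
- by move=> i _; exact: b0.
- by move=> i; exact: sdec.
- have [->|j0] := posnP j; first by rewrite !big_ord0 subr0.
  (* The positions of the [j] largest coordinates: [s ord0] is among them as [0 < j], and
     [s ord_max] is not as [j <= d]. *)
  pose J := [set i | ((s^-1)%g i < j)%N].
  have := @prod_bary_le_sum R d v lv nv b0 uv J (s ord0) (s ord_max).
  rewrite !inE !permK -leqNgt => /(_ j0 jd).
  rewrite (reindex_inj (@perm_inj _ s)) /= [in X in _ <= X](reindex_inj (@perm_inj _ s)) /=.
  rewrite (big_ord_widen d.+1 x (leqW jd)) (big_ord_widen d.+1 x (leqW jd)).
  rewrite -sumE (bigID (fun i : 'I_d.+1 => (i < j)%N)) /= addrAC subrr add0r.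
  by congr (_ <= _); apply: eq_big => i; rewrite ?inE ?permK // /x inord_val.
rewrite -prodE; split=> // e; exists s => i.
by rewrite -(h2 e i) /x ?inord_val // -ltnS.
Qed.

End UpperBound.

(** * The two bounds on the volume product and their equality cases *)

Theorem mainTheorem5 (R : realFieldType) (d : nat) (v : 'I_d.+1 -> 'rV[R]_d) :
  (forall i, lattice_pt (v i)) ->
  simplex_nondeg v ->
  int_pt (convhull v) 0 ->
  (forall z, lattice_pt z -> int_pt (convhull v) z -> z = 0) ->
  (exists w : 'I_d.+1 -> 'rV[R]_d, forall y, convhull w y <-> polar_body (convhull v) y) /\
  (forall w : 'I_d.+1 -> 'rV[R]_d, (forall y, convhull w y <-> polar_body (convhull v) y) ->
     let P := (d`!)%:R ^+ 2 * simplex_vol v * simplex_vol w in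
     [/\ ((d.+1) ^ d.+1)%:R <= P,
         P <= ((sylv d.+1 - 1) ^ 2)%:R,
         (((d.+1) ^ d.+1)%:R = P <-> centroid v = 0) &
         (P = ((sylv d.+1 - 1) ^ 2)%:R <-> unimod_equiv (convhull v) (@Tsimplex R d))]).
Proof.
move=> lv nv int0 uniq0.
have b0 := bary_gt0_of_int_pt nv int0.
have uv : unique_interior v.
  move=> c c1 c0 lat i; rewrite -(bary_uniq nv c1 i); congr bary; apply: uniq0 => //.
  by apply: int_pt_of_bary_gt0 => // k; rewrite bary_uniq.
split; first by exists (polar_vert v) => y; exact: polar_hull.
move=> w hw; cbv zeta; rewrite (volume_product nv b0 hw).
have p0 : 0 < \prod_i bary v 0 i by rewrite prodr_gt0.
have N0 : 0 < (sylvP d)%:R :> R by rewrite ltr0n sylvP_gt0.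
have n0 : 0 < d.+1%:R :> R by rewrite ltr0n.
(* Both bounds are written as inverses, so that all four claims compare products of barycentric
   coordinates. *)
have -> : ((sylv d.+1 - 1) ^ 2)%:R = ((sylvP d)%:R ^- 2)^-1 :> R.
  by rewrite /sylv /= addnK natrX invrK.
have -> : (d.+1 ^ d.+1)%:R = ((d.+1%:R^-1) ^+ d.+1)^-1 :> R.
  by rewrite natrX exprVn invrK.
have [le_hi eq_hi] := prod_bary_ge lv nv b0 uv.
have [] := @leif_AGM R 'I_d.+1 predT (bary v 0) => [i _|]; first exact: ltW.
rewrite card_ord sum_bary // mul1r => le_lo eq_lo.
split.
- by rewrite lef_pV2 // posrE ?exprn_gt0 ?invr_gt0.
- by rewrite lef_pV2 // posrE invr_gt0 exprn_gt0.
- split=> [/invr_inj/esym/eqP|cent].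
    (* Equality in AM-GM makes all coordinates of the origin equal, so each is [1 / (d + 1)]. *)
    rewrite eq_lo => /forall_inP eqb.
    have bE i : bary v 0 i = d.+1%:R^-1.
      apply: (mulfI (x := d.+1%:R)); first by rewrite gt_eqF.
      rewrite divff ?gt_eqF // -[RHS](sum_bary nv 0) mulr_natl -[X in _ *+ X](card_ord d.+1) -sumr_const.
      by apply: eq_bigr => j _; have /forall_inP/(_ j isT)/eqP := eqb i isT.
    rewrite /centroid -[RHS](baryE nv) scaler_sumr.
    by apply: eq_bigr => i _; rewrite bE.
  congr (_^-1); rewrite -[X in _ ^+ X](card_ord d.+1) -prodr_const.
  apply: eq_bigr => i _; rewrite -cent /centroid scaler_sumr.
  rewrite (bary_uniq nv (c := fun=> d.+1%:R^-1)) //.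
  by rewrite sumr_const card_ord -[_ *+ _]mulr_natl divff ?gt_eqF.
- split=> [/invr_inj/esym/[dup] eqP /eq_hi[s bs]|/(bary_of_unimod_equivT nv b0)[s bs]].
    have bmax : bary v 0 (s ord_max) = (sylvP d)%:R^-1.
      by rewrite bs /sylv_bary /= ltnn.
    have gv := generates_sylv lv nv b0 uv bmax (esym eqP).
    (* [s] sorts the coordinates with the smallest last; [vertex_rot] converts this order to that of
       [Tvert]. *)
    apply: (@unimod_equivT _ _ v (perm (@vertex_rot_inj d) * s)) => // i.
    by rewrite permM permE bs.
  congr (_^-1); rewrite -prod_T_bary (reindex_inj (@perm_inj _ s)).
  by apply: eq_bigr => i _; rewrite bs.
Qed.
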